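(* Let $m\ge 1$ be an integer and let $S=S(n_1,n_2,\ldots,n_l)$ be a starlike tree with at least two branches (i.e. $l\ge 2$). Then $$b(K_m\boxtimes S)=\begin{cases}\lceil \frac{m}{2}\rceil, & \text{if } n_1\equiv n_2\equiv\cdots\equiv n_l\equiv 1 \pmod 3;\\ m, & \text{if } n_1\equiv n_2\equiv\cdots\equiv n_l\equiv 2 \pmod 3;\\ \lceil \frac{3m}{2}\rceil, & \text{if } n_1\equiv n_2\equiv\cdots\equiv n_l\equiv 0 \pmod 3.\end{cases}$$
   Context: All graphs are finite, undirected and simple. $K_m$ is the complete graph on $m$ vertices. The strong product $G\boxtimes H$ has vertex set $V(G)\times V(H)$, and $(g_1,h_1)$, $(g_2,h_2)$ are adjacent iff either $g_1=g_2$ and $h_1h_2\in E(H)$, or $g_1g_2\in E(G)$ and $h_1=h_2$, or $g_1g_2\in E(G)$ and $h_1h_2\in E(H)$. A dominating set of $G$ is a set $D\subseteq V(G)$ such that every vertex of $G$ is in $D$ or adjacent to a vertex of $D$; $\gamma(G)$ is the minimum cardinality of a dominating set. For a graph $G$ with at least one edge, the bondage number $b(G)$ is the minimum cardinality of a set $F\subseteq E(G)$ such that $\gamma(G-F)>\gamma(G)$, where $G-F$ is obtained by deleting the edges in $F$ (keeping all vertices). A starlike tree is a tree with at most one vertex of degree more than two; that vertex is called its center (if there is no vertex of degree more than two, any vertex can be chosen as the center). $S(n_1,\ldots,n_l)$, with positive integers $n_1,\dots,n_l$, denotes a starlike tree in which removing the center leaves disjoint paths $P_{n_1},\ldots,P_{n_l}$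 with $n_1,\ldots,n_l$ vertices respectively; these paths are called the branches. (Thus the center is joined to exactly one end vertex of each branch.) *)

(* Defs.v *)
From mathcomp Require Import all_boot.

Set Implicit Arguments.
Unset Strict Implicit.
Unset Printing Implicit Defensive.

Record sgraph := SGraph {
  vertex :> finType;
  adj : rel vertex;
  adj_sym : symmetric adj;
  adj_irrefl : irreflexive adj }.

Section Graph.
Variable G : sgraph.
Implicit Types (x y : G) (D : {set G}) (F : {set {set G}}).

Definition edges : {set {set G}} :=
  [set e | [exists x, exists y, adj x y && (e == [set x; y])]].

Definition degree x := #|[set y | adj x y]|.

Definition connected := forall x y, connect (@adj G) x y.

(* The bound is 2 rather than 0 because an edge xy gives the closed walk
   [:: x; y], which satisfies ucycle. *)
Definition acyclic := forall p : seq G, ucycle (@adj G) p -> size p <= 2.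

Definition is_tree := connected /\ acyclic.

Definition dominating D := [forall v, (v \in D) || [exists u in D, adj u v]].

Definition domination_number : nat :=
  #|[arg min_(D < setT | dominating D) #|D|]|.

Definition del_adj F : rel G := fun x y => adj x y && ([set x; y] \notin F).

Fact del_adj_sym F : symmetric (del_adj F).
Proof. by move=> x y; rewrite /del_adj adj_sym setUC. Qed.

Fact del_adj_irrefl F : irreflexive (del_adj F).
Proof. by move=> x; rewrite /del_adj adj_irrefl. Qed.

Definition del_edges F : sgraph := SGraph (del_adj_sym F) (@del_adj_irrefl F).

Variable A : {set G}.

Definition induced_adj : rel {x : G | x \in A} := fun u v => adj (val u) (val v).

Fact induced_adj_sym : symmetric induced_adj.
Proof. by move=> u v; apply: adj_sym. Qed.

Fact induced_adj_irrefl : irreflexive induced_adj.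
Proof. by move=> u; apply: adj_irrefl. Qed.

Definition induced : sgraph := SGraph induced_adj_sym induced_adj_irrefl.

End Graph.

Section Bondage.
Variable G : sgraph.

Definition raises_domination (F : {set {set G}}) : bool :=
  (F \subset edges G) &&
  (domination_number G < domination_number (del_edges F)).

(* If G has an edge, then edges G itself satisfies raises_domination (lemma
   edges_raise), so that this is the intended minimum; on an edgeless graph,
   where the bondage number is undefined, the value is 0. *)
Definition bondage_number : nat :=
  #|[arg min_(F < edges G | raises_domination F) #|F|]|.

End Bondage.

Lemma dominating_setT (G : sgraph) : dominating [set: G].
Proof. by apply/forallP => v; rewrite inE. Qed.

Lemma domination_number_min (G : sgraph) (D : {set G}) :
  dominating D -> domination_number G <= #|D|.
Proof.
rewrite /domination_number; case: arg_minnP => [|D0 _]; last exact.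
exact: dominating_setT.
Qed.

Lemma domination_number_ex (G : sgraph) :
  exists2 D : {set G}, dominating D & #|D| = domination_number G.
Proof.
rewrite /domination_number; case: arg_minnP => [|D0 dD0 _]; last by exists D0.
exact: dominating_setT.
Qed.

Lemma edges_raise (G : sgraph) (x y : G) :
  adj x y -> raises_domination (edges G).
Proof.
move=> xy; rewrite /raises_domination subxx /=.
have [D dD <-] := domination_number_ex (del_edges (edges G)).
have -> : D = [set: G].
  apply/setP => v; rewrite in_setT; move/forallP: dD => /(_ v).
  case/orP => [//|] /existsP[u /andP[_ /andP[uv]]].
  by rewrite inE; case/existsP; exists u; apply/existsP; exists v; rewrite uv /=.
have yx : y != x by apply: contraTneq xy => ->; rewrite adj_irrefl.
apply: (@leq_ltn_trans #|[set~ y]|).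
  apply: domination_number_min; apply/forallP => v; rewrite !inE.
  case: eqVneq => //= ->; apply/existsP; exists x.
  by rewrite !inE eq_sym yx.
rewrite proper_card // properT; apply/eqP => /setP/(_ y).
by rewrite !inE eqxx.
Qed.

Lemma bondage_numberP (G : sgraph) (x y : G) : adj x y ->
  (exists2 F : {set {set G}}, raises_domination F & #|F| = bondage_number G) /\
  (forall F : {set {set G}}, raises_domination F -> bondage_number G <= #|F|).
Proof.
move=> /edges_raise rE; rewrite /bondage_number.
by case: arg_minnP => // F rF minF; split=> //; exists F.
Qed.

Definition isomorphic (G H : sgraph) :=
  exists f : G -> H, bijective f /\ forall x y, adj (f x) (f y) = adj x y.

Section Complete.
Variable m : nat.

Definition complete_adj : rel 'I_m := fun i j => i != j.

Fact complete_adj_sym : symmetric complete_adj.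
Proof. by move=> i j; rewrite /complete_adj eq_sym. Qed.

Fact complete_adj_irrefl : irreflexive complete_adj.
Proof. by move=> i; rewrite /complete_adj eqxx. Qed.

Definition complete_graph := SGraph complete_adj_sym complete_adj_irrefl.

End Complete.

Section Path.
Variable n : nat.

Definition path_adj : rel 'I_n := fun i j => (i.+1 == j) || (j.+1 == i).

Fact path_adj_sym : symmetric path_adj.
Proof. by move=> i j; rewrite /path_adj orbC. Qed.

Fact path_adj_irrefl : irreflexive path_adj.
Proof. by move=> i; rewrite /path_adj orbb gtn_eqF. Qed.

Definition path_graph := SGraph path_adj_sym path_adj_irrefl.

End Path.

Section StrongProduct.
Variables G H : sgraph.

Definition strong_adj : rel (G * H) := fun p q =>
  [|| (p.1 == q.1) && adj p.2 q.2,
      adj p.1 q.1 && (p.2 == q.2) |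
      adj p.1 q.1 && adj p.2 q.2].

Fact strong_adj_sym : symmetric strong_adj.
Proof.
move=> p q; rewrite /strong_adj (eq_sym p.1) (eq_sym p.2).
by rewrite (adj_sym p.1) (adj_sym p.2).
Qed.

Fact strong_adj_irrefl : irreflexive strong_adj.
Proof. by move=> p; rewrite /strong_adj !adj_irrefl !andbF. Qed.

Definition strong_product := SGraph strong_adj_sym strong_adj_irrefl.

End StrongProduct.

Section DisjointUnion.
Variables (I : finType) (G : I -> sgraph).

Definition dunion_adj : rel {i : I & G i} := fun u v =>
  (tag u == tag v) && adj (tagged u) (tagged_as u v).

Fact dunion_adj_sym : symmetric dunion_adj.
Proof.
case=> i x [j y]; rewrite /dunion_adj /=.
case: (eqVneq i j) => [ij|//]; subst j.
by rewrite !tagged_asE adj_sym.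
Qed.

Fact dunion_adj_irrefl : irreflexive dunion_adj.
Proof. by case=> i x; rewrite /dunion_adj tagged_asE adj_irrefl andbF. Qed.

Definition disjoint_union := SGraph dunion_adj_sym dunion_adj_irrefl.

End DisjointUnion.

(* S is a tree S(n_0, ..., n_{l-1}) whose center is c. *)
Definition starlike (S : sgraph) (c : S) (l : nat) (n : 'I_l -> nat) : Prop :=
  [/\ is_tree S,
      forall v : S, 2 < degree v -> v = c,
      forall i, 0 < n i &
      isomorphic (induced [set~ c]) (disjoint_union (fun i => path_graph (n i)))].

(* Main.v *)
Require Import Defs.
From mathcomp Require Import all_boot zify.

(** Write the vertices of S as (leg, height), the center having height 0, and
call fiber of u the clique of the m copies of a vertex u of S.  Adjacency in
the product is closed adjacency in S, so domination in the product is
domination in S as long as no edge is missing.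

A set of pairwise disjoint closed neighborhoods (a packing) bounds the
domination number from below, and a tiling of S by closed neighborhoods and
pairs of adjacent vertices bounds it from above.  A leg of length 3k + r is
packed and tiled by segments of three consecutive heights, and this gives
the domination number of the product: 1 + (sum of k_i) for r = 0 and r = 1,
and the sum of the k_i + 1 for r = 2.

Few deleted edges do not increase the number.  To put a tile out of use is
expensive: if no copy of u dominates all fibers over N[u] any more, then every
copy of u has lost an edge, which takes at least ceil(m/2) deleted edges
(card_touching); if no vertex dominates the two fibers over an edge uv any
more, then m edges are deleted inside these 2m vertices (card_within); and if
no vertex at all dominates the fiber of v, then m + ceil(m/2) edges are
deleted (card_target).  These costs add up over tiles that are far apart
(card_stars, card_pair_star).  For r = 1 a single tiling is enough.  For r = 2
each leg has several tilings: triples around the heights 3x + 2 below a pair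
of adjacent vertices, and triples around 3x + 1 above it; with only triples
of the second kind a leg also dominates the center.  For r = 0 the center
pays for heights 0 and 1 and the rest of a leg has tilings as before; when a
leg breaks all of these, or the center is broken, the damage already uses up
most of the budget, and another tiling that avoids it is intact
(cover_bad_pair, cover_bad_stars, cover_residue0).

Conversely, a dominating set of minimum size meets every member of the packing
in one vertex, so near the center single vertices of it must dominate whole
fibers alone.  Deleting a matching that gives each candidate a missing
partner makes this impossible: a matching covering the fiber of the center
(r = 1), one between the fibers at heights 1 and 2 of a leg (r = 2), or one
between heights 2 and 3 together with one covering the fiber at height 1
(r = 0). *)

Set Implicit Arguments.
Unset Strict Implicit.
Unset Printing Implicit Defensive.

(** * Domination, partial domination and the bondage number *)

Section Domination.
Variable G : sgraph.
Implicit Types (x y : G) (D T : {set G}) (F : {set {set G}}).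

(** Closed adjacency: x dominates y. *)
Definition cadj x y := (x == y) || adj x y.

Lemma cadj_refl x : cadj x x.
Proof. by rewrite /cadj eqxx. Qed.

Lemma cadj_sym : symmetric cadj.
Proof. by move=> x y; rewrite /cadj eq_sym adj_sym. Qed.

Definition nbhd x : {set G} := [set y | cadj x y].

(** The vertices that dominate T may lie outside T. *)
Definition covers N T :=
  [exists D : {set G},
     (#|D| <= N) && [forall y in T, exists x in D, cadj x y]].

Lemma coversP N T :
  reflect (exists2 D : {set G}, #|D| <= N &
             forall y, y \in T -> exists2 x, x \in D & cadj x y)
          (covers N T).
Proof.
apply: (iffP existsP) => [[D /andP[cD /forall_inP h]]|[D cD h]]; exists D => //.
  by move=> y /h /exists_inP.
by rewrite cD; apply/forall_inP => y /h /exists_inP.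
Qed.

Lemma covers_sub N T T' : T \subset T' -> covers N T' -> covers N T.
Proof.
move=> /subsetP sT /coversP[D cD h]; apply/coversP; exists D => // y /sT.
exact: h.
Qed.

Lemma covers0 : covers 0 set0.
Proof. by apply/coversP; exists set0 => [|y]; rewrite ?cards0 ?inE. Qed.

Lemma coversU N N' T T' :
  covers N T -> covers N' T' -> covers (N + N') (T :|: T').
Proof.
move=> /coversP[D cD h] /coversP[D' cD' h']; apply/coversP; exists (D :|: D').
  by rewrite (leq_trans (leq_card_setU _ _)) // leq_add.
move=> y; rewrite inE => /orP[/h|/h'] [x xD xy]; exists x => //;
  by rewrite inE xD ?orbT.
Qed.

Lemma covers_bigcup (I : finType) (N : I -> nat) (T : I -> {set G}) :
  (forall i, covers (N i) (T i)) -> covers (\sum_i N i) (\bigcup_i T i).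
Proof.
move=> h; apply: (big_ind2 covers) => //; first exact: covers0.
by move=> *; apply: coversU.
Qed.

Lemma covers1 x T : (forall y, y \in T -> cadj x y) -> covers 1 T.
Proof.
move=> h; apply/coversP; exists [set x] => [|y /h xy]; first by rewrite cards1.
by exists x; rewrite ?inE.
Qed.

Lemma not_covers1 T :
  ~~ covers 1 T -> forall x, exists2 y, y \in T & ~~ cadj x y.
Proof.
move=> nT x; apply/exists_inP; rewrite -[X in is_true X]negbK.
apply: contra nT => /exists_inPn h; apply: (@covers1 x) => y /h.
by rewrite negbK.
Qed.

Lemma dominatingP D :
  reflect (forall y, exists2 x, x \in D & cadj x y) (dominating D).
Proof.
apply: (iffP forallP) => h y.
  case/orP: (h y) => [yD|/exists_inP[x xD xy]]; first by exists y; rewrite ?cadj_refl.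
  by exists x => //; rewrite /cadj xy orbT.
case: (h y) => x xD /orP[/eqP<-|xy]; first by rewrite xD.
by apply/orP; right; apply/exists_inP; exists x.
Qed.

Lemma covers_domination_number N : covers N setT -> domination_number G <= N.
Proof.
move=> /coversP[D cD h]; apply: leq_trans cD; apply: domination_number_min.
by apply/dominatingP => y; apply: h; rewrite inE.
Qed.

Lemma dominating_meets_nbhd D x : dominating D -> 0 < #|D :&: nbhd x|.
Proof.
move=> /dominatingP/(_ x)[y yD yx]; apply/card_gt0P; exists y.
by rewrite !inE yD cadj_sym.
Qed.

End Domination.

Lemma dominating_del_edges (G : sgraph) (F : {set {set G}}) (D : {set G}) :
  dominating (G := del_edges F) D -> dominating D.
Proof.
move=> /dominatingP h; apply/dominatingP => y.
have [x xD xy] := h y; exists x => //; move: xy; rewrite /cadj /= /del_adj.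
by case/orP => [->//|/andP[->]]; rewrite orbT.
Qed.

(** N is the domination number: it bounds every dominating set from below, and
the partial covers, used with no edge deleted, bound it from above.  The
covers also show that fewer than B deletions do not raise it, and the last
hypothesis that B deletions can. *)
Lemma bondage_number_eq (G : sgraph) (x y : G) N B :
    adj x y -> 0 < B ->
    (forall D : {set G}, dominating D -> N <= #|D|) ->
    (forall F : {set {set G}}, F \subset edges G -> #|F| < B ->
       covers (G := del_edges F) N setT) ->
    (exists F : {set {set G}}, [/\ F \subset edges G, #|F| <= B &
       forall D : {set G}, dominating (G := del_edges F) D -> N < #|D|]) ->
  bondage_number G = B.
Proof.
move=> xy B0 lowN cov [F0 [sF0 cF0 hF0]].
have gN : domination_number G = N.
  apply/eqP; rewrite eqn_leq; apply/andP; split; last first.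
    by have [D dD <-] := domination_number_ex G; apply: lowN.
  have c0 : covers (G := del_edges set0) N [set: G].
    by apply: cov; rewrite ?sub0set ?cards0.
  apply: leq_trans (covers_domination_number c0).
  have [D dD <-] := domination_number_ex (del_edges (set0 : {set {set G}})).
  exact/domination_number_min/(dominating_del_edges dD).
have [[F rF cF] minB] := bondage_numberP xy.
apply/eqP; rewrite eqn_leq; apply/andP; split.
  apply: leq_trans cF0; apply: minB.
  rewrite /raises_domination sF0 gN /=.
  by have [D dD <-] := domination_number_ex (del_edges F0); apply: hF0.
rewrite leqNgt -cF; apply/negP => ltF; case/andP: rF => sF.
by rewrite gN ltnNge covers_domination_number // cov.
Qed.

(** * Deleted edges in the strong product with a complete graph *)

(** Charge each vertex of V to a member of E that contains it.  With k = 2 this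
is the cost of spoiling all the vertices of V by deleted edges. *)
Lemma double_count (T : finType) (E : {set {set T}}) (V : {set T}) k :
    {in V, forall x, exists2 e, e \in E & x \in e} ->
    {in E, forall e : {set T}, #|e :&: V| <= k} ->
  #|V| <= #|E| * k.
Proof.
move=> cov small; rewrite -sum_nat_const.
apply: leq_trans (leq_sum _ small).
have -> : \sum_(e in E) #|e :&: V| = \sum_(e in E) \sum_(x in V) (x \in e).
  apply: eq_bigr => e _; rewrite -sum1_card big_mkcond /= [RHS]big_mkcond /=.
  by apply: eq_bigr => x _; rewrite inE andbC; case: (x \in V); case: (x \in e).
rewrite exchange_big /= -sum1_card; apply: leq_sum => x /cov[e eE xe].
by rewrite (bigD1 e) //= xe.
Qed.

Section Product.
Variables (m : nat) (S : sgraph).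
Implicit Types (u v w : S) (B : {set S}).

Notation G := (strong_product (complete_graph m) S).
Implicit Types (x y : G) (F : {set {set G}}).

Definition fib B : {set G} := [set x : G | x.2 \in B].

Lemma fibU B B' : fib (B :|: B') = fib B :|: fib B'.
Proof. by apply/setP => x; rewrite !inE. Qed.

Lemma fib_bigcup (I : finType) (B : I -> {set S}) :
  fib (\bigcup_i B i) = \bigcup_i fib (B i).
Proof.
apply/setP => x; rewrite inE; apply/bigcupP/bigcupP => -[i _ h]; exists i => //;
  by move: h; rewrite inE.
Qed.

Lemma fibS B B' : B \subset B' -> fib B \subset fib B'.
Proof. by move=> /subsetP sB; apply/subsetP => x; rewrite !inE; apply: sB. Qed.

Lemma fibT : fib setT = setT.
Proof. by apply/setP => x; rewrite !inE. Qed.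

Lemma card_fib B : #|fib B| = m * #|B|.
Proof.
have -> : fib B = setX setT B by apply/setP => -[i u]; rewrite !inE.
by rewrite cardsX cardsT card_ord.
Qed.

(** Two distinct vertices of the product with a complete graph are adjacent as
soon as their projections are equal or adjacent. *)
Lemma strong_adjE x y : adj x y = (x != y) && cadj x.2 y.2.
Proof.
case: x y => [i u] [j v]; rewrite /= /strong_adj /= /complete_adj /cadj -pair_eqE /=.
rewrite /pair_eq /=.
case: (eqVneq i j) => //= _; rewrite ?orbF.
by case: eqVneq => [->|]; rewrite ?adj_irrefl.
Qed.

Lemma del_cadjE F x y :
  @cadj (del_edges F) x y = (x == y) || cadj x.2 y.2 && ([set x; y] \notin F).
Proof.
rewrite /cadj -[X in _ || X]/(del_adj F x y) /del_adj strong_adjE.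
by rewrite -andbA; case: eqVneq.
Qed.

(** The ends of an edge project to equal or adjacent vertices: this is what keeps
the edges that damage distant parts of S apart. *)
Lemma edge_ends F e x y : F \subset edges G -> e \in F -> x \in e -> y \in e ->
  cadj x.2 y.2.
Proof.
move=> /subsetP sF /sF; rewrite inE => /existsP[a /existsP[b /andP[ab /eqP->]]].
move: ab; rewrite strong_adjE => /andP[_ ab]; rewrite !inE.
by move=> /pred2P[]-> /pred2P[]->; rewrite ?cadj_refl // cadj_sym.
Qed.

Lemma card_edge F e : F \subset edges G -> e \in F -> #|e| <= 2.
Proof.
move=> /subsetP sF /sF; rewrite inE => /existsP[a /existsP[b /andP[_ /eqP->]]].
by rewrite cards2; case: eqP.
Qed.

Section Faults.
Variable F : {set {set G}}.
Hypothesis sF : F \subset edges G.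

Notation covF := (@covers (del_edges F)).

Definition touching u := [set e in F | [exists x in e, x.2 == u]].
Definition within u v := [set e in F | e \subset fib [set u; v]].

Lemma not_covers1_edge B x :
    ~~ covF 1 (fib B) -> (forall v, v \in B -> cadj x.2 v) ->
  exists y, [/\ y.2 \in B, y != x & [set x; y] \in F].
Proof.
move=> /not_covers1/(_ x)[y yB]; rewrite del_cadjE negb_or => /andP[yx ned] xB.
exists y; move: yB ned; rewrite inE => yB; rewrite (xB _ yB) /= negbK => ->.
by rewrite eq_sym.
Qed.

(** Each of the m copies of u has lost an edge, and an edge has two ends. *)
Lemma card_touching u : ~~ covF 1 (fib (nbhd u)) -> uphalf m <= #|touching u|.
Proof.
move=> nc; have: #|fib [set u]| <= #|touching u| * 2.
  apply: double_count => [x|e]; last first.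
    rewrite inE => /andP[eF _]; apply: leq_trans (card_edge sF eF).
    by rewrite subset_leq_card // subsetIl.
  rewrite !inE => /eqP xu.
  have [|y [_ _ xyF]] := @not_covers1_edge _ x nc.
    by move=> v; rewrite inE xu.
  exists [set x; y]; last by rewrite !inE eqxx.
  by rewrite inE xyF; apply/exists_inP; exists x; rewrite ?inE ?eqxx // xu.
by rewrite card_fib cards1; lia.
Qed.

(** The fibers of two adjacent vertices form a clique on 2m vertices, each of
which has lost an edge of this clique. *)
Lemma card_within u v :
  adj u v -> ~~ covF 1 (fib [set u; v]) -> m <= #|within u v|.
Proof.
move=> uv nc; have: #|fib [set u; v]| <= #|within u v| * 2.
  apply: double_count => [x|e]; last first.
    rewrite inE => /andP[eF _]; apply: leq_trans (card_edge sF eF).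
    by rewrite subset_leq_card // subsetIl.
  move=> xuv; have xuv2 : x.2 \in [set u; v] by move: xuv; rewrite inE.
  have [w|y [yuv _ xyF]] := @not_covers1_edge _ x nc.
    move: xuv2; rewrite !inE /cadj => /pred2P[]-> /pred2P[]->;
      by rewrite ?eqxx // ?uv ?orbT // adj_sym uv orbT.
  exists [set x; y]; last by rewrite !inE eqxx.
  rewrite inE xyF; apply/subsetP => z; rewrite !inE => /pred2P[]->.
    by move: xuv2; rewrite !inE.
  by move: yuv; rewrite !inE.
have nuv : u != v by apply: contraTneq uv => ->; rewrite adj_irrefl.
by rewrite card_fib cards2 nuv; lia.
Qed.

(** No edge touches the fibers of two distinct nonadjacent vertices, so the costs
of card_touching add up. *)
Lemma card_stars (U : {set S}) :
    {in U &, forall u v, cadj u v -> u = v} ->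
    {in U, forall u, ~~ covF 1 (fib (nbhd u))} ->
  #|U| * uphalf m <= #|F|.
Proof.
move=> indU bad; rewrite -sum_nat_const.
apply: leq_trans (leq_sum _ (fun u uU => card_touching (bad u uU))) _.
have -> : \sum_(u in U) #|touching u| =
          \sum_(u in U) \sum_(e in F) (e \in touching u).
  apply: eq_bigr => u _; rewrite -sum1_card big_mkcond /= [RHS]big_mkcond /=.
  by apply: eq_bigr => e _; rewrite inE; case: (e \in F).
rewrite exchange_big /= -sum1_card; apply: leq_sum => e eF.
rewrite -big_mkcondr /= sum1_card; apply/card_le1_eqP => u v.
move=> /andP[uU]; rewrite inE eF => /exists_inP[x xe /eqP xu].
move=> /andP[vU]; rewrite inE eF => /exists_inP[y ye /eqP yv]; apply: indU => //.
by rewrite -xu -yv; apply: edge_ends eF ye xe.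
Qed.

Lemma card_pair u v :
  adj u v -> ~~ covF 1 (fib [set u; v]) -> m <= #|F|.
Proof.
move=> uv /(card_within uv) h; apply: leq_trans h _.
by apply: subset_leq_card; apply/subsetP => e; rewrite inE => /andP[].
Qed.

Lemma card_pair_star u v w :
    adj u v -> w != u -> w != v ->
    ~~ covF 1 (fib [set u; v]) -> ~~ covF 1 (fib (nbhd w)) ->
  m + uphalf m <= #|F|.
Proof.
move=> uv wu wv /(card_within uv) h1 /card_touching h2.
apply: leq_trans (leq_add h1 h2) _; rewrite -cardsUI.
have -> : within u v :&: touching w = set0.
  apply/setP => e; rewrite !inE; apply/negP => /andP[/andP[_ /subsetP es]].
  move=> /andP[_ /exists_inP[x /es]]; rewrite !inE => /pred2P[]-> /eqP E.
    by rewrite E eqxx in wu.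
  by rewrite E eqxx in wv.
rewrite cards0 addn0; apply: subset_leq_card; apply/subsetP => e.
by rewrite !inE => /orP[] /andP[].
Qed.

(** Every copy of u has lost an edge to the fiber of v; such an edge contains
only one copy of u, so there are at least m of them.  Every copy of v has
lost an edge inside the fiber, which takes uphalf m further edges. *)
Lemma card_target u v :
  adj u v -> ~~ covF 1 (fib [set v]) -> m + uphalf m <= #|F|.
Proof.
move=> uv nc; have nuv : u != v by apply: contraTneq uv => ->; rewrite adj_irrefl.
pose E1 := within v v; pose E2 := [set e in F | ~~ (e \subset fib [set v; v])].
have h1 : #|fib [set v]| <= #|E1| * 2.
  apply: double_count => [x|e]; last first.
    rewrite inE => /andP[eF _]; apply: leq_trans (card_edge sF eF).
    by rewrite subset_leq_card // subsetIl.
  rewrite !inE => /eqP xv.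
  have [w|y [yv _ xyF]] := @not_covers1_edge _ x nc.
    by rewrite inE xv => /eqP->; apply: cadj_refl.
  exists [set x; y]; last by rewrite !inE eqxx.
  rewrite inE xyF; apply/subsetP => z; rewrite !inE orbb => /pred2P[]->.
    by rewrite xv.
  by move: yv; rewrite inE.
have h2 : #|fib [set u]| <= #|[set e in E2 | [exists x in e, x.2 == v]]| * 1.
  apply: double_count => [x|e].
    rewrite !inE => /eqP xu.
    have [w|y [yv _ xyF]] := @not_covers1_edge _ x nc.
      by rewrite inE xu => /eqP->; rewrite /cadj uv orbT.
    exists [set x; y]; last by rewrite !inE eqxx.
    rewrite !inE xyF /=; apply/andP; split.
      apply/subsetPn; exists x; first by rewrite !inE eqxx.
      by rewrite !inE xu orbb.
    by apply/exists_inP; exists y; rewrite ?inE ?eqxx ?orbT // -in_set1.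
  rewrite !inE => /andP[/andP[eF _] /exists_inP[y ye /eqP yv]].
  have ce := card_edge sF eF; rewrite -ltnS; apply: leq_trans ce.
  apply: proper_card; rewrite properE subsetIl; apply/subsetPn; exists y => //.
  by rewrite !inE ye yv eq_sym.
have h3 : #|[set e in E2 | [exists x in e, x.2 == v]]| <= #|E2|.
  by apply: subset_leq_card; apply/subsetP => e; rewrite inE => /andP[].
have : #|F| = #|E1| + #|E2|.
  rewrite -(cardsID [set e : {set G} | e \subset fib [set v; v]] F).
  by congr (_ + _); apply: eq_card => e; rewrite !inE // andbC.
by move: h1 h2; rewrite !card_fib !cards1; lia.
Qed.

End Faults.

(** A matching of the fiber of u; when m is odd the last copy of u is matched
with a copy of v. *)
Lemma near_matching u v : adj u v ->
  exists M : {set {set G}}, [/\ M \subset edges G, #|M| <= uphalf m &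
    forall x, x.2 = u -> exists y, [/\ y.2 \in [set u; v], y != x & [set x; y] \in M]].
Proof.
move=> uv; have nuv : u != v by apply: contraTneq uv => ->; rewrite adj_irrefl.
have lt_double (j : 'I_(uphalf m)) : j.*2 < m by have := ltn_ord j; lia.
pose a j : 'I_m := Ordinal (lt_double j).
pose mate (i : 'I_m) : G := if insub i.+1 is Some k then (k, u) else (i, v).
have mateP i : (mate i).2 \in [set u; v] /\ mate i != (i, u) :> G.
  rewrite /mate; case: insubP => [k _ ki|_] /=; rewrite !inE eqxx ?orbT.
    by split=> //; rewrite -pair_eqE /pair_eq /= -val_eqE /=; move: ki => /= ki; lia.
  by split=> //; rewrite -pair_eqE /pair_eq /= eq_sym (negPf nuv) andbF.
pose e j : {set G} := [set ((a j, u) : G); mate (a j)].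
exists (e @: setT); split.
- apply/subsetP => _ /imsetP[j _ ->]; rewrite inE.
  apply/existsP; exists ((a j, u) : G); apply/existsP; exists (mate (a j)).
  have [mj nj] := mateP (a j); rewrite strong_adjE eq_sym nj eqxx andbT /=.
  by move: mj; rewrite !inE /cadj => /pred2P[]->; rewrite ?eqxx // uv orbT.
- by rewrite (leq_trans (leq_imset_card _ _)) // cardsT card_ord.
case=> i w /= ->{w}.
have lti : i./2 < uphalf m by have := ltn_ord i; lia.
have [odd_i|even_i] := boolP (odd i); last first.
  have Ei : a (Ordinal lti) = i by apply: val_inj => /=; lia.
  have [mi ni] := mateP i; exists (mate i); split=> //.
  by apply/imsetP; exists (Ordinal lti); rewrite // /e Ei.
(* an odd i is the mate of i - 1 *)
exists (a (Ordinal lti), u); rewrite !inE eqxx; split=> //.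
  by rewrite -pair_eqE /pair_eq /= -val_eqE /= eqxx andbT; lia.
apply/imsetP; exists (Ordinal lti); rewrite // /e setUC; congr [set _; _].
rewrite /mate; case: insubP => [k _ /= ki|/=]; last by have := ltn_ord i; lia.
by congr (_, _); apply: val_inj => /=; move: ki => /=; lia.
Qed.

Lemma perfect_matching u v : adj u v ->
  exists M : {set {set G}}, [/\ M \subset edges G, #|M| <= m &
    forall x, x.2 \in [set u; v] ->
      exists y, [/\ y.2 \in [set u; v], y.2 != x.2 & [set x; y] \in M]].
Proof.
move=> uv; have nuv : u != v by apply: contraTneq uv => ->; rewrite adj_irrefl.
pose e (i : 'I_m) : {set G} := [set ((i, u) : G); ((i, v) : G)].
exists (e @: setT); split.
- apply/subsetP => _ /imsetP[i _ ->]; rewrite inE.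
  apply/existsP; exists ((i, u) : G); apply/existsP; exists ((i, v) : G).
  by rewrite strong_adjE /cadj /= uv orbT -pair_eqE /pair_eq /= eqxx nuv eqxx.
- by rewrite (leq_trans (leq_imset_card _ _)) // cardsT card_ord.
case=> i w; rewrite !inE /= => /pred2P[]->.
  exists (i, v); rewrite !inE /= eqxx orbT eq_sym nuv.
  by split=> //; apply/imsetP; exists i.
exists (i, u); rewrite !inE /= eqxx nuv.
by split=> //; rewrite setUC; apply/imsetP; exists i.
Qed.

End Product.

(** * Coordinates on a starlike tree *)

(** The vertex at height p of leg i is pt i p.  The center is at height 0 of every
leg, so lg has no meaning there, and neither has pt i p for p > n i.  The
last field says that closed adjacency compares heights inside one leg, where
the center belongs to all legs. *)
Record leg_coordinates (S : sgraph) (l : nat) (n : 'I_l -> nat) :=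
  LegCoordinates {
    lg : S -> 'I_l;
    ht : S -> nat;
    pt : 'I_l -> nat -> S;
    ht_pt : forall i p, p <= n i -> ht (pt i p) = p;
    lg_pt : forall i p, 0 < p <= n i -> lg (pt i p) = i;
    ht_le : forall u, ht u <= n (lg u);
    ht_inj : forall u v,
      ht u = ht v -> (ht u == 0) || (lg u == lg v) -> u = v;
    cadj_ht : forall u v, cadj u v =
      [&& ht u <= (ht v).+1, ht v <= (ht u).+1
        & [|| ht u == 0, ht v == 0 | lg u == lg v]] }.

(** An isomorphism with a disjoint union of paths, read as functions on S: ps is
the position on the path, and Q inverts (lg, ps).  Outside A the values are
arbitrary, i0 and c being defaults. *)
Lemma path_forest_coordinates (S : sgraph) (A : {set S}) l (n : 'I_l -> nat)
    (i0 : 'I_l) (c : S) :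
    isomorphic (induced A) (disjoint_union (fun i => path_graph (n i))) ->
  exists (lg : S -> 'I_l) (ps : S -> nat) (Q : 'I_l -> nat -> S),
    [/\ forall u, u \in A -> ps u < n (lg u),
        forall i p, p < n i -> [/\ Q i p \in A, lg (Q i p) = i & ps (Q i p) = p],
        {in A &, forall u v, lg u = lg v -> ps u = ps v -> u = v} &
        {in A &, forall u v, adj u v =
           (lg u == lg v) && (((ps u).+1 == ps v) || ((ps v).+1 == ps u))}].
Proof.
move=> [f [[g fK gK] f_adj]].
pose cd u : option {i : 'I_l & 'I_(n i)} :=
  omap f (insub u : option (induced A)).
pose lg u := if cd u is Some t then tag t else i0.
pose ps u : nat := if cd u is Some t then tagged t else 0.
pose Q i p : S := if insub p is Some o
  then val (g (Tagged (fun i => 'I_(n i)) (o : 'I_(n i)))) else c.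
have cdE u (uA : u \in A) : cd u = Some (f (Sub u uA)).
  by rewrite /cd (insubT (mem A)).
exists lg, ps, Q; split.
- by move=> u uA; rewrite /ps /lg cdE.
- move=> i p pn; rewrite /Q insubT; set t := g _.
  have E : cd (val t) = Some (f t).
    by rewrite (cdE _ (valP t)); congr (Some (f _)); apply: val_inj.
  by rewrite /lg /ps E /t gK; split=> //; apply: valP.
- move=> u v uA vA; rewrite /lg /ps !cdE /= => E1 E2.
  suff /(can_inj fK)/(congr1 val) : f (Sub u uA) = f (Sub v vA) by [].
  move: E1 E2; case: (f _) => i p; case: (f _) => j q /= E; subst j.
  by move=> /val_inj->.
- move=> u v uA vA; rewrite /lg /ps !cdE /=.
  have -> : adj u v = adj (Sub u uA : induced A) (Sub v vA : induced A) by [].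
  rewrite -f_adj /= /dunion_adj; case: (f _) => i p; case: (f _) => j q /=.
  by case: (eqVneq i j) => //= E; subst j; rewrite tagged_asE.
Qed.

Section Starlike.
Variables (S : sgraph) (c : S) (l : nat) (n : 'I_l -> nat).
Hypothesis tree : is_tree S.
Hypothesis deg : forall v : S, 2 < degree v -> v = c.
Hypothesis n_gt0 : forall i, 0 < n i.
Variables (lg : S -> 'I_l) (ps : S -> nat) (Q : 'I_l -> nat -> S).
Hypothesis ps_lt : forall u, u != c -> ps u < n (lg u).
Hypothesis QP : forall i p, p < n i ->
  [/\ Q i p != c, lg (Q i p) = i & ps (Q i p) = p].
Hypothesis ps_inj : forall u v, u != c -> v != c ->
  lg u = lg v -> ps u = ps v -> u = v.
Hypothesis adj_ps : forall u v, u != c -> v != c -> adj u v =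
  (lg u == lg v) && (((ps u).+1 == ps v) || ((ps v).+1 == ps u)).

Let QK u : u != c -> Q (lg u) (ps u) = u.
Proof.
by move=> uc; have [Qc l1 p1] := QP (ps_lt uc); apply: ps_inj.
Qed.

Let adjQ i p : p.+1 < n i -> adj (Q i p) (Q i p.+1).
Proof.
move=> pn; have [c1 l1 p1] := QP pn; have [c2 l2 p2] := QP (ltnW pn).
by rewrite adj_ps // l1 l2 p1 p2 !eqxx.
Qed.

(** Otherwise no edge would leave the branch, against connectedness. *)
Lemma center_attached i : exists p, p < n i /\ adj c (Q i p).
Proof.
have [/existsP[p cp]|/existsPn none] :=
  boolP [exists p : 'I_(n i), adj c (Q i p)]; first by exists p.
pose A := [pred u | (u != c) && (lg u == i)].
have clA : closed (@adj S) A.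
  have half u v : adj u v -> u \in A -> v \in A.
    move=> uv; rewrite !inE => /andP[uc /eqP lu].
    have [vc|vc] := eqVneq v c.
      have pu : ps u < n i by rewrite -lu ps_lt.
      by have := none (Ordinal pu); rewrite /= -lu QK // adj_sym -vc uv.
    by move: uv; rewrite adj_ps // lu eq_sym => /andP[].
  move=> u v uv; apply/idP/idP; first exact: half.
  by apply: half; rewrite adj_sym.
have [Qc lQ _] := QP (n_gt0 i).
have := closed_connect clA (tree.1 (Q i 0) c).
by rewrite !inE Qc lQ !eqxx.
Qed.

Lemma path_along_leg i p d : p + d < n i ->
  path (@adj S) (Q i p) (map (Q i) (iota p.+1 d)) /\
  last (Q i p) (map (Q i) (iota p.+1 d)) = Q i (p + d).
Proof.
elim: d p => [|d IH] p h; first by rewrite addn0.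
have [|h1 h2] := IH p.+1; first by rewrite addSnnS.
rewrite /= h1 h2 addSnnS; split=> //; rewrite andbT; apply: adjQ.
by apply: leq_ltn_trans h; rewrite -addn1 leq_add2l.
Qed.

(** The center and the part of the branch between its two neighbors would form
a cycle. *)
Lemma center_attached_once i p q :
  p < q < n i -> adj c (Q i p) -> adj c (Q i q) -> False.
Proof.
move=> /andP[pq qn] cp cq.
have E : p + (q - p) = q by rewrite subnKC // ltnW.
have [|h1 h2] := @path_along_leg i p (q - p); first by rewrite E.
have Qn x : x \in iota p (q - p).+1 -> x < n i.
  by rewrite mem_iota; move=> /andP[_]; rewrite addnS E ltnS => /leq_ltn_trans->.
have /tree.2 : ucycle (@adj S) (c :: map (Q i) (iota p (q - p).+1)).
  apply/andP; split.
    by rewrite /cycle rcons_path /= cp h1 h2 E adj_sym.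
  rewrite cons_uniq; apply/andP; split.
    by apply/mapP => -[x /Qn/QP[Qc _ _] xc]; rewrite -xc eqxx in Qc.
  rewrite map_inj_in_uniq ?iota_uniq // => x y /Qn/QP[_ _ px] /Qn/QP[_ _ py] xy.
  by rewrite -px -py xy.
by rewrite /= size_map size_iota !ltnS leqn0 subn_eq0 leqNgt pq.
Qed.

(** An inner vertex of the branch attached to the center would have degree 3. *)
Lemma center_attached_end i p :
  p < n i -> adj c (Q i p) -> p = 0 \/ p = (n i).-1.
Proof.
move=> pn cp; have [->|p0] := posnP p; first by left.
right; apply/eqP; rewrite eqn_leq -ltnS prednK // pn /= leqNgt.
apply/negP => pl; have pl' : p.+1 < n i by rewrite -(prednK (n_gt0 i)).
have [Qc lQ pQ] := QP pn; have [Qc1 lQ1 pQ1] := QP pl'.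
have pp : p.-1 < n i by apply: leq_ltn_trans pn; apply: leq_pred.
have [Qc0 lQ0 pQ0] := QP pp.
suff /deg E : 2 < degree (Q i p) by rewrite E eqxx in Qc.
have <- : #|c |: [set Q i p.-1; Q i p.+1]| = 3.
  rewrite cardsU1 cards2 !inE negb_or ![c == _]eq_sym Qc0 Qc1 /=.
  by case: eqP => // /(congr1 ps); rewrite pQ0 pQ1; case: (p) p0 => //= p'; lia.
apply: subset_leq_card; apply/subsetP => v; rewrite !inE => /or3P[]/eqP->.
- by rewrite adj_sym.
- by rewrite adj_sym -{2}(prednK p0); apply: adjQ; rewrite prednK.
exact: adjQ.
Qed.

(** The height of a vertex is counted from the end of its branch at which the
center is attached, so the branches attached at their last position are
read backwards. *)
Lemma coordinates_of_legs (a : 'I_l -> nat) :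
    (forall i, a i < n i /\ adj c (Q i (a i))) ->
  inhabited (leg_coordinates S n).
Proof.
move=> aP.
have a_end i : a i = 0 \/ a i = (n i).-1.
  by have [h1 h2] := aP i; apply: center_attached_end.
have adj_c v : v != c -> adj c v = (ps v == a (lg v)).
  move=> vc; have [an ca] := aP (lg v); apply/idP/eqP => [cv|E]; last first.
    by rewrite -(QK vc) E.
  have pn := ps_lt vc; rewrite -(QK vc) in cv.
  by case: (ltngtP (ps v) (a (lg v))) => // h;
    [case: (@center_attached_once (lg v) (ps v) (a (lg v)))
    |case: (@center_attached_once (lg v) (a (lg v)) (ps v))]; rewrite ?h.
pose ht u := if u == c then 0 else
  if a (lg u) == 0 then (ps u).+1 else n (lg u) - ps u.
pose pt i p := if p == 0 then c else
  if a i == 0 then Q i p.-1 else Q i (n i - p).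
have pt_idx i p : 0 < p <= n i -> exists q,
    [/\ q < n i, pt i p = Q i q & p = if a i == 0 then q.+1 else n i - q].
  move=> h; rewrite /pt; case: eqP => [|_]; first by lia.
  by case: eqP => _; [exists p.-1 | exists (n i - p)]; split=> //; lia.
have ht_gt0 u : u != c -> 0 < ht u.
  by move=> uc; have := ps_lt uc; rewrite /ht (negPf uc); case: eqP => _; lia.
have htc : ht c = 0 by rewrite /ht eqxx.
exists; apply: (@LegCoordinates S l n lg ht pt).
- move=> i p pn; have [->|p0] := posnP p; first by rewrite /pt eqxx.
  have [|q [qn -> ->]] := @pt_idx i p; first by rewrite p0.
  by have [Qc lQ pQ] := QP qn; rewrite /ht (negPf Qc) lQ pQ.
- move=> i p h; have [q [qn -> _]] := pt_idx i p h.
  by have [_ ->] := QP qn.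
- move=> u; rewrite /ht; case: eqVneq => // /ps_lt; case: eqP => _; lia.
- move=> u v; have [->|uc] := eqVneq u c; have [->|vc] := eqVneq v c => //.
  + by rewrite htc => E; have := ht_gt0 v vc; rewrite -E.
  + by rewrite htc => E; have := ht_gt0 u uc; rewrite E.
  have := ht_gt0 u uc => hu E; rewrite (gtn_eqF hu) => /eqP luv.
  apply: ps_inj => //; have := ps_lt uc; have := ps_lt vc; move: E.
  by rewrite /ht (negPf uc) (negPf vc) luv; case: eqP => _; lia.
move=> u v; have [->|uc] := eqVneq u c; have [->|vc] := eqVneq v c.
- by rewrite cadj_refl htc.
- rewrite /cadj eq_sym (negPf vc) adj_c // htc /= andbT.
  have := ps_lt vc; rewrite /ht (negPf vc).
  by case: (a_end (lg v)) => E; case: ifP => ?; lia.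
- rewrite cadj_sym /cadj eq_sym (negPf uc) adj_c // htc /= orbT andbT.
  have := ps_lt uc; rewrite /ht (negPf uc).
  by case: (a_end (lg u)) => E; case: ifP => ?; lia.
rewrite /cadj adj_ps // (gtn_eqF (ht_gt0 u uc)) (gtn_eqF (ht_gt0 v vc)) /=.
have [luv|luv] := eqVneq (lg u) (lg v); last first.
  by rewrite !andbF orbF; apply/eqP => uv; rewrite uv eqxx in luv.
have -> : (u == v) = (ps u == ps v).
  by apply/eqP/eqP => [->|]; last exact: ps_inj.
have := ps_lt uc; have := ps_lt vc.
by rewrite /ht (negPf uc) (negPf vc) luv /=; case: ifP => _; lia.
Qed.

End Starlike.

Lemma starlike_coordinates (S : sgraph) (c : S) l (n : 'I_l -> nat) :
  0 < l -> starlike c n -> inhabited (leg_coordinates S n).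
Proof.
move=> l0 [tree deg n_gt0].
move=> /(path_forest_coordinates (Ordinal l0) c)[lg [ps [Q [h1 h2 h3 h4]]]].
have inC u : (u \in [set~ c]) = (u != c) by rewrite !inE.
have ps_lt u : u != c -> ps u < n (lg u) by rewrite -inC; apply: h1.
have QP i p : p < n i -> [/\ Q i p != c, lg (Q i p) = i & ps (Q i p) = p].
  by rewrite -inC; apply: h2.
have ps_inj u v : u != c -> v != c -> lg u = lg v -> ps u = ps v -> u = v.
  by rewrite -!inC; apply: h3.
have adj_ps u v : u != c -> v != c -> adj u v =
    (lg u == lg v) && (((ps u).+1 == ps v) || ((ps v).+1 == ps u)).
  by rewrite -!inC; apply: h4.
have [a aP] := fin_all_exists (center_attached tree n_gt0 ps_lt QP ps_inj adj_ps).
exact: (coordinates_of_legs tree deg n_gt0 ps_lt QP ps_inj adj_ps aP).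
Qed.

(** * Tilings and packings by segments of legs *)

(** The first failure of P, or k.-1 when there is none, is a place where a leg can
switch from tiles that need P to tiles that need Q. *)
Lemma split_index (P Q : pred nat) k :
    0 < k -> (forall a b, a < b < k -> P a || Q b) ->
  exists j, [/\ j < k, forall x, x < j -> P x & forall x, j < x < k -> Q x].
Proof.
move=> k0 PQ; pose B x := (x == k.-1) || ~~ P x.
have exB : exists x, B x by exists k.-1; rewrite /B eqxx.
case: (ex_minnP exB) => j Bj minj; exists j.
have jk : j <= k.-1 by apply: minj; rewrite /B eqxx.
split=> [|x xj|x /andP[jx xk]]; first by lia.
  by apply: contraTT xj => nPx; rewrite -leqNgt minj // /B nPx orbT.
case/orP: Bj => [/eqP|nPj]; first by lia.
by have := PQ j x; rewrite jx xk (negPf nPj); apply.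
Qed.

Section Legs.
Variables (m : nat) (S : sgraph) (l : nat) (n : 'I_l -> nat).
Variable C : leg_coordinates S n.
Implicit Types (i : 'I_l) (p q r : nat) (u v : S).

Notation G := (strong_product (complete_graph m) S).
Notation lg := (lg C).
Notation ht := (ht C).
Notation pt := (pt C).

(** The center lies on every leg, so that a segment starting at height 0 contains
it. *)
Definition seg i p q : {set S} :=
  [set v | (p <= ht v < q) && ((ht v == 0) || (lg v == i))].

Definition low p : {set S} := [set v | ht v < p].

Lemma seg_sub i p q p' q' : p' <= p -> q <= q' -> seg i p q \subset seg i p' q'.
Proof.
by move=> hp hq; apply/subsetP => v; rewrite !inE => /andP[h ->]; lia.
Qed.

Lemma seg1P i p v : p <= n i -> v \in seg i p p.+1 -> v = pt i p.
Proof.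
move=> pn; rewrite inE => /andP[hp lv].
have hv : ht v = ht (pt i p) by rewrite (ht_pt C) //; lia.
apply: (ht_inj hv); case: eqP lv => //= h0 /eqP->.
by rewrite (lg_pt C) ?eqxx //; move: hv; rewrite ht_pt //; lia.
Qed.

Lemma pt_seg i p q r : p <= r < q -> r <= n i -> pt i r \in seg i p q.
Proof.
move=> rpq rn; rewrite inE (ht_pt C) // rpq /=.
by case: eqP => //= /eqP r0; rewrite (lg_pt C) ?eqxx // lt0n r0.
Qed.

Lemma pt0 i j : pt i 0 = pt j 0.
Proof. by apply: (@ht_inj _ _ _ C); rewrite !ht_pt. Qed.

Lemma seg_nbhd i p : 0 < p <= n i -> seg i p.-1 p.+2 \subset nbhd (pt i p).
Proof.
move=> /andP[p0 pn]; apply/subsetP => v; rewrite !inE (cadj_ht C) (ht_pt C) //.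
rewrite (lg_pt C) ?p0 // (eq_sym i) => /andP[/andP[h1 h2] ->].
by rewrite orbT andbT; lia.
Qed.

Lemma nbhd_seg i p : 0 < p <= n i -> nbhd (pt i p) \subset seg i p.-1 p.+2.
Proof.
move=> /andP[p0 pn]; apply/subsetP => v; rewrite !inE (cadj_ht C) (ht_pt C) //.
rewrite (lg_pt C) ?p0 // (eq_sym i) => /and3P[h1 h2]; case: eqP => [|_ /= ->].
  by lia.
by rewrite andbT; lia.
Qed.

Lemma nbhd_pt0 i : nbhd (pt i 0) = low 2.
Proof.
apply/setP => v; rewrite !inE (cadj_ht C) (ht_pt C) //=; lia.
Qed.

(** An arithmetic criterion for stars whose centers are neither equal nor
adjacent, so that no deleted edge breaks both. *)
Definition far i p j q :=
  [|| p.+1 < q, q.+1 < p | [&& i != j, 0 < p & 0 < q]].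

Lemma far_cadj i p j q :
  p <= n i -> q <= n j -> far i p j q -> ~~ cadj (pt i p) (pt j q).
Proof.
move=> pn qn; rewrite (cadj_ht C) !(ht_pt C) // /far.
case/or3P => [h|h|/and3P[ij p0 q0]]; rewrite ?negb_and; try lia.
by rewrite !(lg_pt C) ?p0 ?q0 // (negPf ij); lia.
Qed.

Lemma adj_pt i p : p < n i -> adj (pt i p) (pt i p.+1).
Proof.
move=> pn; have pn' := ltnW pn.
have: cadj (pt i p) (pt i p.+1).
  rewrite (cadj_ht C) !(ht_pt C) // (@lg_pt _ _ _ C i p.+1) //.
  by case: posnP => [->|p0] //; rewrite (lg_pt C) ?p0 // eqxx; lia.
rewrite /cadj; case: eqP => // /(congr1 ht).
by rewrite !(ht_pt C) //; lia.
Qed.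

Section Tiling.
Variable F : {set {set G}}.

Definition cov N (B : {set S}) := @covers (del_edges F) N (fib m B).
(** The star around the vertex at height p of leg i is still a usable tile. *)
Definition clean i p := cov 1 (nbhd (pt i p)).

Lemma cov_sub N (B B' : {set S}) : B \subset B' -> cov N B' -> cov N B.
Proof. by move=> sB; apply: covers_sub; apply: fibS. Qed.

Lemma cov_cat N N' i p q r :
  cov N (seg i p q) -> cov N' (seg i q r) -> cov (N + N') (seg i p r).
Proof.
move=> c c'; apply: covers_sub (coversU c c'); rewrite -fibU.
apply: fibS; apply/subsetP => v; rewrite !inE -andb_orl => /andP[h ->].
by rewrite andbT; lia.
Qed.

Lemma cov_empty i p : cov 0 (seg i p p).
Proof.
apply: covers_sub (covers0 _); apply/subsetP => x.
by rewrite !inE; lia.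
Qed.

(** The triples centered at heights 3x + r + 1 tile a run of the leg. *)
Lemma cov_run i r a b :
    a <= b -> (forall x, a <= x < b -> 3 * x + r < n i /\ clean i (3 * x + r).+1) ->
  cov (b - a) (seg i (3 * a + r) (3 * b + r)).
Proof.
move=> ab; have -> : b = a + (b - a) by rewrite subnKC.
rewrite addKn; elim: (b - a) => [|d IH] h.
  by rewrite addn0; apply: cov_empty.
rewrite -addn1; apply: cov_cat (IH _) _ => [x xd|]; first by apply: h; lia.
have [|hn hok] := h (a + d); first by lia.
apply: cov_sub hok.
have -> : seg i (3 * (a + d) + r) (3 * (a + (d + 1)) + r) =
          seg i (3 * (a + d) + r).+1.-1 (3 * (a + d) + r).+3.
  by congr (seg _ _ _); lia.
by apply: seg_nbhd.
Qed.

Lemma cov_pair i p :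
  p < n i -> cov 1 [set pt i p; pt i p.+1] -> cov 1 (seg i p p.+2).
Proof.
move=> pn; apply: cov_sub; apply/subsetP => v vs; rewrite !inE.
have : (v \in seg i p p.+1) || (v \in seg i p.+1 p.+2).
  by move: vs; rewrite !inE -andb_orl => /andP[h ->]; rewrite andbT; lia.
by case/orP => /seg1P ->; rewrite ?eqxx ?orbT // (ltnW pn).
Qed.

Lemma cov_point i p : p <= n i -> cov 1 [set pt i p] -> cov 1 (seg i p p.+1).
Proof.
move=> pn; apply: cov_sub; apply/subsetP => v /seg1P; rewrite inE => -> //.
Qed.

(** The legs may be tiled separately above a core around the center. *)
Lemma cov_all_core N0 (N : 'I_l -> nat) p :
    cov N0 (low p) -> (forall i, cov (N i) (seg i p (n i).+1)) ->
  cov (N0 + \sum_i N i) setT.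
Proof.
move=> c0 c; apply: covers_sub (coversU c0 (covers_bigcup c)).
rewrite -fib_bigcup -fibU; apply: fibS; apply/subsetP => v _; rewrite inE.
have [|vp] := boolP (v \in low p) => //=; apply/bigcupP; exists (lg v) => //.
by move: vp; rewrite !inE eqxx orbT andbT -leqNgt => -> /=; rewrite ltnS ht_le.
Qed.

(** One leg, i0, takes care of the center; the boolean i != i0 is the height at
which leg i starts. *)
Lemma cov_all_leg (N : 'I_l -> nat) i0 :
  (forall i, cov (N i) (seg i (i != i0) (n i).+1)) -> cov (\sum_i N i) setT.
Proof.
move=> c; apply: covers_sub (covers_bigcup c); rewrite -fib_bigcup.
apply: fibS; apply/subsetP => v _; apply/bigcupP.
have hle := ht_le C v; have [h0|h0] := posnP (ht v).
  by exists i0; rewrite // inE h0 eqxx.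
by exists (lg v); rewrite // inE eqxx orbT andbT; lia.
Qed.

Lemma two_stars i p j q : p <= n i -> q <= n j -> far i p j q ->
  F \subset edges G -> #|F| < 2 * uphalf m -> clean i p || clean j q.
Proof.
move=> pn qn /far_cadj h sF; apply: contraLR; rewrite negb_or => /andP[bi bj].
have {h} := h pn qn => nad; rewrite -leqNgt.
have <- : #|[set pt i p; pt j q]| = 2.
  by rewrite cards2; case: eqP nad => // ->; rewrite cadj_refl.
apply: card_stars => // [u v|u].
  rewrite !inE => /pred2P[]-> /pred2P[]-> //; first by rewrite (negPf nad).
  by rewrite cadj_sym (negPf nad).
by rewrite !inE => /pred2P[]->.
Qed.

Lemma three_stars i p j q i' p' : p <= n i -> q <= n j -> p' <= n i' ->
  far i p j q -> far i p i' p' -> far j q i' p' ->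
  F \subset edges G -> #|F| < 3 * uphalf m -> [|| clean i p, clean j q | clean i' p'].
Proof.
move=> pn qn pn' f1 f2 f3 sF; apply: contraLR; rewrite !negb_or => /and3P[b1 b2 b3].
have {f1}n1 := far_cadj pn qn f1; have {f2}n2 := far_cadj pn pn' f2.
have {f3}n3 := far_cadj qn pn' f3; rewrite -leqNgt.
have ne u v : ~~ @cadj S u v -> u != v.
  by apply: contraNneq => ->; rewrite cadj_refl.
have <- : #|pt i p |: [set pt j q; pt i' p']| = 3.
  by rewrite cardsU1 cards2 !inE !negb_or !ne.
apply: card_stars => // [u v|u].
  rewrite !inE => /or3P[]/eqP-> /or3P[]/eqP-> //;
    rewrite ?(negPf n1) ?(negPf n2) ?(negPf n3) //;
    by rewrite cadj_sym ?(negPf n1) ?(negPf n2) ?(negPf n3).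
by rewrite !inE => /or3P[]/eqP->.
Qed.

Lemma pair_ok i p : p < n i -> F \subset edges G -> #|F| < m ->
  cov 1 [set pt i p; pt i p.+1].
Proof.
by move=> pn sF; apply: contraLR => b; rewrite -leqNgt (card_pair sF (adj_pt pn)).
Qed.

Lemma pair_or_star i p j q : p < n i -> pt j q \notin [set pt i p; pt i p.+1] ->
  F \subset edges G -> #|F| < m + uphalf m -> cov 1 [set pt i p; pt i p.+1] || clean j q.
Proof.
move=> pn; rewrite !inE negb_or => /andP[n1 n2] sF; apply: contraLR.
rewrite negb_or => /andP[b1 b2]; rewrite -leqNgt.
exact: (card_pair_star sF (adj_pt pn) n1 n2 b1 b2).
Qed.

Lemma target_ok i p : p < n i -> F \subset edges G -> #|F| < m + uphalf m ->
  cov 1 [set pt i p] && cov 1 [set pt i p.+1].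
Proof.
move=> pn sF; apply: contraLR; rewrite negb_and -leqNgt => /orP[]b.
  by apply: card_target b => //; rewrite adj_sym; apply: adj_pt.
by apply: card_target b => //; apply: adj_pt.
Qed.

End Tiling.

Section Packing.
Variable D : {set G}.

Definition wt (B : {set S}) := #|D :&: fib m B|.

Lemma wt_sub (B B' : {set S}) : B \subset B' -> wt B <= wt B'.
Proof. by move=> sB; rewrite subset_leq_card // setIS // fibS. Qed.

Lemma wt_cat i p q r : p <= q <= r ->
  wt (seg i p q) + wt (seg i q r) <= wt (seg i p r).
Proof.
move=> pqr; rewrite /wt -cardsUI.
have -> : D :&: fib m (seg i p q) :&: (D :&: fib m (seg i q r)) = set0.
  by apply/setP => x; rewrite !inE; lia.
rewrite cards0 addn0 -setIUr -fibU; apply: wt_sub; apply/subsetP => v.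
by rewrite !inE -andb_orl => /andP[h ->]; rewrite andbT; lia.
Qed.

Lemma wt_nbhd u : 0 < m -> dominating D -> 0 < wt (nbhd u).
Proof.
move=> m_gt0 dD.
apply: leq_trans (dominating_meets_nbhd ((Ordinal m_gt0, u) : G) dD) _.
rewrite subset_leq_card // setIS //; apply/subsetP => x; rewrite !inE.
rewrite {1}/cadj strong_adjE => /orP[/eqP<-|/andP[_ //]].
exact: cadj_refl.
Qed.

(** Packing: the stars centered at heights 3x + r + 1 are disjoint, and each
meets the dominating set. *)
Lemma wt_run i r a b :
    0 < m -> dominating D ->
    a <= b -> (forall x, a <= x < b -> 3 * x + r < n i) ->
  b - a <= wt (seg i (3 * a + r) (3 * b + r)).
Proof.
move=> m_gt0 dD ab; have -> : b = a + (b - a) by rewrite subnKC.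
rewrite addKn; elim: (b - a) => [//|d IH] h.
apply: leq_trans (wt_cat (q := 3 * (a + d) + r) _ _); last by lia.
rewrite -addn1 leq_add ?IH // => [x xd|]; first by apply: h; lia.
apply: leq_trans (wt_nbhd (pt i (3 * (a + d) + r).+1) m_gt0 dD) _.
apply: wt_sub; apply: subset_trans (nbhd_seg _) _.
  by rewrite /= h //; lia.
by apply/subsetP => v; rewrite !inE => /andP[hv ->]; lia.
Qed.

Lemma wt_split p (q : 'I_l -> nat) : 0 < p ->
  wt (low p) + \sum_i wt (seg i p (q i)) <= #|D|.
Proof.
move=> p0; rewrite -(cardsID (fib m (low p)) D) leq_add2l.
rewrite -[X in _ <= X]sum1_card (partition_big (fun x : G => lg x.2) predT) //=.
apply: leq_sum => i _; rewrite sum1_card; apply: subset_leq_card.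
apply/subsetP => x; rewrite !inE => /and3P[xD /andP[px _] lx].
apply/andP; rewrite !inE xD -leqNgt px; split=> //.
by move: lx => /orP[/eqP h0|//]; rewrite h0 leqNgt p0 in px.
Qed.

(** When the packing bound is attained, every member of the packing attains it. *)
Lemma wt_tight p (q : 'I_l -> nat) N0 (N : 'I_l -> nat) : 0 < p ->
    N0 <= wt (low p) -> (forall i, N i <= wt (seg i p (q i))) ->
    #|D| <= N0 + \sum_i N i ->
  wt (low p) <= N0 /\ forall i, wt (seg i p (q i)) <= N i.
Proof.
move=> p0 h0 hN hD; have hT := leq_trans (wt_split q p0) hD.
have hS : \sum_i N i <= \sum_i wt (seg i p (q i)) by apply: leq_sum.
split=> [|i]; first by lia.
have hSi : \sum_(j | j != i) N j <= \sum_(j | j != i) wt (seg j p (q j)).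
  exact: leq_sum.
have EN : \sum_j N j = N i + \sum_(j | j != i) N j by apply: bigD1.
have Ew : \sum_j wt (seg j p (q j)) =
  wt (seg i p (q i)) + \sum_(j | j != i) wt (seg j p (q j)) by apply: bigD1.
by lia.
Qed.

End Packing.

End Legs.

(** * The three residue classes *)

Section Cases.
Variables (m : nat) (S : sgraph) (l : nat) (n : 'I_l -> nat).
Variable C : leg_coordinates S n.
Hypothesis m_gt0 : 0 < m.
Variables i0 i1 : 'I_l.
Hypothesis i01 : i0 != i1.
Hypothesis n_gt0 : forall i, 0 < n i.

Notation G := (strong_product (complete_graph m) S).
Notation lg := (lg C).
Notation ht := (ht C).
Notation pt := (pt C).
Notation seg := (seg C).
Notation low := (low C).
Notation wt := (@wt m S).
Implicit Types (F : {set {set G}}) (D : {set G}) (x y z : G).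

(** If x is the only vertex of D over B, then everything whose neighborhood lies
over B is dominated by x, and no edge from x to it is deleted. *)
Lemma lone_dominator F D (B : {set S}) x y :
    dominating (G := del_edges F) D ->
    {in D, forall z, z.2 \in B -> z = x} -> nbhd y.2 \subset B ->
  cadj x.2 y.2 /\ ([set x; y] \in F -> y = x).
Proof.
move=> /dominatingP/(_ y)[z zD zy] lone /subsetP sB.
have zy2 : cadj z.2 y.2.
  by move: zy; rewrite del_cadjE => /orP[/eqP->|/andP[]//]; rewrite cadj_refl.
have <- : z = x by apply: lone => //; apply: sB; rewrite inE cadj_sym.
split=> // zyF; move: zy; rewrite del_cadjE zyF andbF orbF => /eqP-> //.
Qed.

Lemma dominated_nonempty F D u (B : {set S}) :
  dominating (G := del_edges F) D -> nbhd u \subset B ->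
  exists2 x, x \in D & x.2 \in B.
Proof.
move=> dD sB; have := wt_nbhd u m_gt0 (dominating_del_edges dD).
move=> /leq_trans/(_ (wt_sub D sB)) /card_gt0P[x].
by rewrite !inE => /andP[]; exists x.
Qed.

Lemma wt_le1 D (B : {set S}) x : wt D B <= 1 -> x \in D -> x.2 \in B ->
  {in D, forall z, z.2 \in B -> z = x}.
Proof.
by move=> /card_le1_eqP h xD xB z zD zB; apply: h; rewrite !inE ?zD ?xD.
Qed.

Let product_edge :
  adj ((Ordinal m_gt0, pt i0 0) : G) ((Ordinal m_gt0, pt i0 1) : G).
Proof.
rewrite strong_adjE /cadj /= (adj_pt C) // orbT andbT.
by apply/eqP => -[/(congr1 ht)]; rewrite !(ht_pt C).
Qed.

Section Residue1.
Variable k : 'I_l -> nat.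
Hypothesis nE : forall i, n i = 3 * k i + 1.

(** All stars are intact: the star of the center and the triples centered at
heights 3x + 3 tile S. *)
Lemma cover_residue1 F : F \subset edges G -> #|F| < uphalf m ->
  cov F (1 + \sum_i k i) setT.
Proof.
move=> sF cF.
have allok i p : p <= n i -> clean C F i p.
  move=> pn; apply: contraLR cF => b; rewrite -leqNgt.
  apply: leq_trans (card_touching sF b) _; apply: subset_leq_card.
  by apply/subsetP => e; rewrite inE => /andP[].
apply: (@cov_all_core _ _ _ _ C _ _ _ 2).
  by rewrite -(nbhd_pt0 C i0); apply: allok.
move=> i; have -> : (n i).+1 = 3 * k i + 2 by rewrite nE; lia.
rewrite -[X in cov _ X _]subn0.
apply: (@cov_run _ _ _ _ C _ _ 2 0) => // x xk; split; first by rewrite nE; lia.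
by apply: allok; rewrite nE; lia.
Qed.

(** The triples centered at heights 3x + 4, together with the triple 0, 1, 2 of
one leg, form a packing that leaves the other legs uncovered at heights 1
and 2; this freedom is what forces the vertex below height 3 to be a copy of
the center in raise_residue1. *)
Lemma pack_residue1 D i : dominating D -> k i <= wt D (seg i 3 (3 * k i + 3)).
Proof.
move=> dD; rewrite -[X in X <= _]subn0.
by apply: (@wt_run _ _ _ _ C _ _ 3 0) => // x xk; rewrite nE; lia.
Qed.

Lemma low3_residue1 D : dominating D -> 0 < wt D (low 3).
Proof.
move=> dD; apply: leq_trans (wt_nbhd (pt i0 1) m_gt0 dD) _; apply: wt_sub.
apply: subset_trans (nbhd_seg C _) _; first by rewrite n_gt0.
by apply/subsetP => v; rewrite !inE => /andP[/andP[]].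
Qed.

Lemma lower_residue1 D : dominating D -> 1 + \sum_i k i <= #|D|.
Proof.
move=> dD.
apply: leq_trans (@wt_split _ _ _ _ C D 3 (fun i => 3 * k i + 3) isT).
rewrite leq_add ?low3_residue1 //; apply: leq_sum => i _.
exact: pack_residue1.
Qed.

(** A minimum dominating set has a single vertex x below height 3.  It dominates
height 1 of two legs, so it is a copy of the center, and it must dominate
the whole fiber of the center and height 1; its partner in the matching is
missed. *)
Lemma raise_residue1 : exists F, [/\ F \subset edges G, #|F| <= uphalf m &
  forall D, dominating (G := del_edges F) D -> 1 + \sum_i k i < #|D|].
Proof.
have [F [sF cF FP]] := near_matching m (adj_pt C (n_gt0 i0)).
exists F; split=> // D dD; rewrite ltnNge; apply/negP => hD.
have dD' := dominating_del_edges dD.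
have [//||w3 _] := @wt_tight _ _ _ _ C _ 3 (fun i => 3 * k i + 3) 1 k isT _ _ hD.
  exact: low3_residue1.
  by move=> i; apply: pack_residue1.
have low_nbhd u : ht u <= 1 -> nbhd u \subset low 3.
  by move=> u1; apply/subsetP => v; rewrite !inE (cadj_ht C); lia.
have low1 i : nbhd (pt i 1) \subset low 3 by rewrite low_nbhd // ht_pt.
have [x xD x3] := dominated_nonempty dD (low1 i0).
have lone := wt_le1 w3 xD x3.
have h i : cadj x.2 (pt i 1).
  by have [] := lone_dominator (y := (Ordinal m_gt0, pt i 1)) dD lone (low1 i).
have hx0 : ht x.2 = 0.
  have := h i0; have := h i1.
  rewrite !(cadj_ht C) !(ht_pt C) // !(lg_pt C) ?n_gt0 //.
  by move: i01; case: (lg x.2 =P i0) => [->|]; lia.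
have x0 : x.2 = pt i0 0 by apply: (@ht_inj _ _ _ C); rewrite ?(ht_pt C) // hx0.
have [y [yB nyx xyF]] := FP x x0.
have [|_ /(_ xyF) E] := lone_dominator (y := y) dD lone; last by rewrite E eqxx in nyx.
by apply: low_nbhd; move: yB; rewrite !inE => /pred2P[]->; rewrite ht_pt.
Qed.

Lemma bondage_residue1 : bondage_number G = uphalf m.
Proof.
apply: (bondage_number_eq (N := 1 + \sum_i k i) product_edge).
- by move: m_gt0; clear; lia.
- exact: lower_residue1.
- by move=> F sF cF; rewrite -fibT; apply: cover_residue1.
exact: raise_residue1.
Qed.

End Residue1.

Section Residue2.
Variable k : 'I_l -> nat.
Hypothesis nE : forall i, n i = 3 * k i + 2.

(** On a leg, two broken stars at heights 3x + 2 and 3y + 1 with x < y would cost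
2 * uphalf m >= m edges, so a pair between runs of intact stars exists.  The
center is dominated by a leg all of whose stars at heights 3x + 1 are intact;
if there is none, two legs with a broken star cost 2 * uphalf m as well. *)
Lemma cover_residue2 F : F \subset edges G -> #|F| < m ->
  cov F (\sum_i (k i).+1) setT.
Proof.
move=> sF cF.
have cF2 : #|F| < 2 * uphalf m by lia.
have leg_covered i : cov F (k i).+1 (seg i 1 (n i).+1).
  have [|j [jk Rj Lj]] := @split_index (fun x : nat => clean C F i (3 * x + 2))
      (fun x : nat => clean C F i (3 * x + 1)) (k i).+1 isT.
    by move=> a b ab; apply: two_stars => //; rewrite /far ?nE; lia.
  have -> : (k i).+1 = (j - 0) + 1 + ((k i).+1 - j.+1) by lia.
  apply: (@cov_cat _ _ _ _ _ _ _ _ _ _ (3 * j.+1 + 0)).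
    apply: (@cov_cat _ _ _ _ _ _ _ _ _ _ (3 * j + 1)).
      apply: (@cov_run _ _ _ _ C _ _ 1 0 j) => // x xj.
      by split; [rewrite nE; lia | rewrite -addnS; apply: Rj].
    have -> : 3 * j.+1 + 0 = (3 * j + 1).+2 by lia.
    by apply: cov_pair; [rewrite nE; lia | apply: pair_ok => //; rewrite nE; lia].
  have -> : (n i).+1 = 3 * (k i).+1 + 0 by rewrite nE; lia.
  apply: cov_run => // x xj; split; first by rewrite nE; lia.
  by rewrite addn0 -addn1; apply: Lj.
have [/existsP[i /forallP hi]|/existsPn noL] :=
    boolP [exists i, [forall x : 'I_(k i).+1, clean C F i (3 * x + 1)]].
  apply: (@cov_all_leg _ _ _ _ C _ _ i) => j.
  case: eqVneq => [->|_] /=; last exact: leg_covered.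
  have -> : (n i).+1 = 3 * (k i).+1 + 0 by rewrite nE; lia.
  rewrite -[X in cov _ X _]subn0; apply: (@cov_run _ _ _ _ C _ _ 0 0) => // x xk.
  split; first by rewrite nE; lia.
  by rewrite addn0 -addn1; apply: (hi (Ordinal (proj2 (andP xk)))).
have /forallPn[x nx] := noL i0; have /forallPn[y ny] := noL i1.
have : clean C F i0 (3 * x + 1) || clean C F i1 (3 * y + 1).
  apply: two_stars => //; rewrite ?nE /far ?i01.
  - by have := ltn_ord x; lia.
  - by have := ltn_ord y; lia.
  by rewrite !addn1 !orbT.
by rewrite (negPf nx) (negPf ny).
Qed.

Lemma pack_residue2 D i : dominating D ->
  (k i).+1 <= wt D (seg i 1 (3 * k i + 4)).
Proof.
move=> dD; have -> : 3 * k i + 4 = 3 * (k i).+1 + 1 by lia.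
rewrite -[X in X <= _]subn0; apply: (@wt_run _ _ _ _ C _ _ 1 0) => // x xk.
by rewrite nE; lia.
Qed.

Lemma lower_residue2 D : dominating D -> \sum_i (k i).+1 <= #|D|.
Proof.
move=> dD.
apply: leq_trans (@wt_split _ _ _ _ C D 1 (fun i => 3 * k i + 4) isT).
rewrite -[X in X <= _]add0n leq_add //; apply: leq_sum => i _.
exact: pack_residue2.
Qed.

(** A minimum dominating set has no vertex over the center and a single one, x,
over heights 1 to 3 of leg i0.  So x dominates heights 1 and 2 alone and lies
over one of them, where it has a missing partner. *)
Lemma raise_residue2 : exists F, [/\ F \subset edges G, #|F| <= m &
  forall D, dominating (G := del_edges F) D -> \sum_i (k i).+1 < #|D|].
Proof.
have n2 : 1 < n i0 by rewrite nE; lia.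
have [F [sF cF FP]] := perfect_matching m (adj_pt C n2).
exists F; split=> // D dD; rewrite ltnNge; apply/negP => hD.
have dD' := dominating_del_edges dD.
have [//|i|w1 wi] := @wt_tight _ _ _ _ C _ 1 (fun i => 3 * k i + 4) 0
    (fun i => (k i).+1) isT _ _ hD; first exact: pack_residue2.
have w4 : wt D (seg i0 1 4) <= 1.
  have h : (k i0).+1 - 1 <= wt D (seg i0 (3 * 1 + 1) (3 * (k i0).+1 + 1)).
    by apply: wt_run => // x xk; rewrite nE; lia.
  have E : 3 * (k i0).+1 + 1 = 3 * k i0 + 4 by lia.
  have := @wt_cat _ _ _ _ C D i0 1 4 (3 * k i0 + 4).
  by have := wi i0; move: h; rewrite E -[3 * 1 + 1]/4; lia.
have sub p : 0 < p <= 2 -> nbhd (pt i0 p) \subset seg i0 0 4.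
  move=> hp; apply: subset_trans (nbhd_seg C _) _; first by lia.
  by apply/subsetP => v; rewrite !inE => /andP[h ->]; lia.
have w04 : wt D (seg i0 0 4) <= 1.
  apply: leq_trans w4; rewrite subset_leq_card //; apply/subsetP => x.
  rewrite !inE => /andP[xD xs]; rewrite xD /=.
  have : x \notin D :&: fib m (low 1).
    by move: w1; rewrite leqn0 cards_eq0 => /eqP->; rewrite inE.
  by rewrite !inE xD -leqNgt => ->; case/andP: xs => /andP[_ ->] ->.
have [x xD x4] := dominated_nonempty dD (sub 1 isT).
have lone := wt_le1 w04 xD x4.
have h p : 0 < p <= 2 -> cadj x.2 (pt i0 p).
  move=> /sub sp.
  by have [] := lone_dominator (y := (Ordinal m_gt0, pt i0 p)) dD lone sp.
have xB : x.2 \in [set pt i0 1; pt i0 2].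
  have := h 1 isT; have := h 2 isT; rewrite !(cadj_ht C) !(ht_pt C) ?n_gt0 //.
  move=> h2 h1.
  have : (x.2 \in seg i0 1 2) || (x.2 \in seg i0 2 3).
    by move: x4; rewrite !inE; lia.
  by case/orP => /seg1P->; rewrite ?inE ?eqxx ?orbT ?n_gt0.
have [y [yB nyx xyF]] := FP x xB.
have [|_ /(_ xyF) E] := lone_dominator (y := y) dD lone; last by rewrite E eqxx in nyx.
by move: yB; rewrite !inE => /pred2P[]->; apply: sub.
Qed.

Lemma bondage_residue2 : bondage_number G = m.
Proof.
apply: (bondage_number_eq (N := \sum_i (k i).+1) product_edge) => //.
- exact: lower_residue2.
- by move=> F sF cF; rewrite -fibT; apply: cover_residue2.
exact: raise_residue2.
Qed.

End Residue2.

Section Residue0.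
Variable k : 'I_l -> nat.
Hypothesis nE : forall i, n i = 3 * k i.

Let k_gt0 i : 0 < k i.
Proof. by have := n_gt0 i; rewrite nE; lia. Qed.

(** One leg may use one tile more than its k_i, in exchange for dominating the
center as well. *)
Lemma sum_extra (i : 'I_l) : \sum_j (k j + (j == i)) = 1 + \sum_j k j.
Proof.
rewrite big_split /= addnC; congr (_ + _).
by rewrite (bigD1 i) //= eqxx big1 // => j /negPf->.
Qed.

Section Cover.
Variable F : {set {set G}}.
Hypothesis sF : F \subset edges G.
Hypothesis cF : #|F| < m + uphalf m.

Let cF3 : #|F| < 3 * uphalf m.
Proof. by have := cF; lia. Qed.

Let good_pair i a := cov F 1 [set pt i (3 * a + 2); pt i (3 * a + 2).+1].

Lemma pt_notin i p j q : p < n i -> q <= n j ->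
  [|| q < p, p.+1 < q | (i != j) && (0 < q)] ->
  pt j q \notin [set pt i p; pt i p.+1].
Proof.
move=> pn qn h; rewrite !inE; apply/pred2P => -[] E.
  have hE := congr1 ht E; have lE := congr1 lg E.
  rewrite !(ht_pt C) // ?(ltnW pn) // in hE; subst q.
  case/or3P: h => [|?|/andP[ij p0]]; try lia.
  by rewrite !(lg_pt C) ?p0 ?(ltnW pn) // in lE; rewrite lE eqxx in ij.
have hE := congr1 ht E; have lE := congr1 lg E.
rewrite !(ht_pt C) // in hE; subst q.
case/or3P: h => [|?|/andP[ij p0]]; try lia.
by rewrite !(lg_pt C) ?p0 // in lE; rewrite lE eqxx in ij.
Qed.

Lemma run_whole i : (forall x : nat, x < k i -> clean C F i (3 * x + 2)) ->
  cov F (k i) (seg i 1 (n i).+1).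
Proof.
move=> h; have -> : (n i).+1 = 3 * k i + 1 by rewrite nE; lia.
rewrite -[X in cov _ X _]subn0; apply: (@cov_run _ _ _ _ C _ _ 1 0) => // x xk.
by split; [rewrite nE; lia | rewrite -addnS; apply: h].
Qed.

(** The pair at heights 3a + 2, 3a + 3 costs m, so all stars that are not centered
in it are intact.  Leg i is tiled by the triples centered at 3x + 1 up to the
center 3a + 1, which include the center of S and reach height 3a + 2, by a
vertex that dominates height 3a + 3 only, and by the triples centered at
3x + 2 above. *)
Lemma cover_bad_pair i a : a < k i -> ~~ good_pair i a ->
  cov F (1 + \sum_j k j) setT.
Proof.
move=> ak bad.
have okp j q : q <= n j ->
    [|| q < 3 * a + 2, 3 * a + 3 < q | (i != j) && (0 < q)] -> clean C F j q.
  move=> qn hq; have h : 3 * a + 2 < n i by rewrite nE; lia.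
  have nin : pt j q \notin [set pt i (3 * a + 2); pt i (3 * a + 2).+1].
    by apply: pt_notin => //; lia.
  have := pair_or_star h nin sF cF.
  by rewrite -[cov _ _ _]/(good_pair i a) (negPf bad).
rewrite -(sum_extra i); apply: (@cov_all_leg _ _ _ _ C _ _ i) => j.
case: eqVneq => [->|ji] /=; last first.
  rewrite addn0; apply: run_whole => x xk; apply: okp; first by rewrite nE; lia.
  by rewrite eq_sym ji addnS !orbT.
have -> : k i + 1 = (a.+1 - 0) + 1 + (k i - a.+1) by lia.
apply: (@cov_cat _ _ _ _ _ _ _ _ _ _ (3 * a.+1 + 1)).
  apply: (@cov_cat _ _ _ _ _ _ _ _ _ _ (3 * a.+1 + 0)).
    apply: (@cov_run _ _ _ _ C _ _ 0 0) => // x xa.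
    by split; [rewrite nE; lia | apply: okp; [rewrite nE; lia | lia]].
  have -> : 3 * a.+1 + 1 = (3 * a.+1 + 0).+1 by lia.
  apply: cov_point; first by rewrite nE; lia.
  have h : 3 * a + 2 < n i by rewrite nE; lia.
  have /andP[_] := target_ok C h sF cF.
  by have -> : (3 * a + 2).+1 = 3 * a.+1 + 0 by lia.
have -> : (n i).+1 = 3 * k i + 1 by rewrite nE; lia.
apply: cov_run => // x xa.
by split; [rewrite nE; lia | apply: okp; [rewrite nE; lia | lia]].
Qed.

(** The two broken stars leave fewer than uphalf m deleted edges, so all stars far
from both are intact.  Leg i is tiled by triples centered at 3x + 1 up to
height 3a + 2, the pair 3a + 3, 3a + 4, triples centered at 3x + 3, the pair
3b + 2, 3b + 3, and triples centered at 3x + 2.  The first pair is intact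
since, with the broken star at 3b + 2, it would cost m + uphalf m. *)
Lemma cover_bad_stars i a b : a < b < k i ->
    (forall c, c < k i -> good_pair i c) ->
    ~~ clean C F i (3 * a + 3) -> ~~ clean C F i (3 * b + 2) ->
  cov F (1 + \sum_j k j) setT.
Proof.
move=> abk pairs badL badR.
have okp j q : q <= n j ->
    [|| q < 3 * a + 2, 3 * a + 4 < q < 3 * b + 1, 3 * b + 3 < q
      | (i != j) && (0 < q)] -> clean C F j q.
  move=> qn hq.
  have h1 : 3 * a + 3 <= n i by rewrite nE; lia.
  have h2 : 3 * b + 2 <= n i by rewrite nE; lia.
  have f1 : far i (3 * a + 3) j q by rewrite /far; lia.
  have f2 : far i (3 * b + 2) j q by rewrite /far; lia.
  have f3 : far i (3 * a + 3) i (3 * b + 2) by rewrite /far; lia.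
  have := three_stars C h1 h2 qn f3 f1 f2 sF cF3.
  by rewrite (negPf badL) (negPf badR).
rewrite -(sum_extra i); apply: (@cov_all_leg _ _ _ _ C _ _ i) => j.
case: eqVneq => [->|ji] /=; last first.
  rewrite addn0; apply: run_whole => x xk; apply: okp; first by rewrite nE; lia.
  by rewrite eq_sym ji addnS !orbT.
have -> : k i + 1 = (a.+1 - 0) + 1 + (b - a.+1) + 1 + (k i - b.+1) by lia.
apply: (@cov_cat _ _ _ _ _ _ _ _ _ _ (3 * b.+1 + 1)); last first.
  have -> : (n i).+1 = 3 * k i + 1 by rewrite nE; lia.
  apply: cov_run => [|x xb]; first by lia.
  by split; [rewrite nE; lia | apply: okp; [rewrite nE; lia | lia]].
apply: (@cov_cat _ _ _ _ _ _ _ _ _ _ (3 * b + 2)); last first.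
  have -> : 3 * b.+1 + 1 = (3 * b + 2).+2 by lia.
  by apply: cov_pair; [rewrite nE; lia | apply: pairs; lia].
apply: (@cov_cat _ _ _ _ _ _ _ _ _ _ (3 * a.+1 + 2)); last first.
  apply: cov_run => [|x xb]; first by lia.
  by split; [rewrite nE; lia | apply: okp; [rewrite nE; lia | lia]].
apply: (@cov_cat _ _ _ _ _ _ _ _ _ _ (3 * a.+1 + 0)).
  apply: (@cov_run _ _ _ _ C _ _ 0 0) => // x xa.
  by split; [rewrite nE; lia | apply: okp; [rewrite nE; lia | lia]].
have -> : 3 * a.+1 + 2 = (3 * a.+1 + 0).+2 by lia.
have h : 3 * a.+1 + 0 < n i by rewrite nE; lia.
apply: cov_pair => //.
have nin : pt i (3 * b + 2) \notin
    [set pt i (3 * a.+1 + 0); pt i (3 * a.+1 + 0).+1].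
  by apply: pt_notin => //; [rewrite nE; lia | lia].
by have := pair_or_star h nin sF cF; rewrite (negPf badR) orbF.
Qed.

(** Heights 1 and 0 being left to the center, a leg is tiled by triples centered
at 3x + 3, one pair, and triples centered at 3x + 2.  What prevents this for
every choice of the pair is what the two previous lemmas treat. *)
Lemma cover_leg i : ~~ cov F (1 + \sum_j k j) setT ->
  cov F (k i) (seg i 2 (n i).+1).
Proof.
move=> nall.
have pairs a : a < k i -> good_pair i a.
  by move=> ak; apply: contraNT nall; apply: cover_bad_pair.
have [|j [jk Lj Rj]] := @split_index (fun x : nat => clean C F i (3 * x + 3))
      (fun x : nat => clean C F i (3 * x + 2)) (k i) (k_gt0 i).
  move=> a b ab; apply: contraNT nall; rewrite negb_or => /andP[].
  exact: cover_bad_stars.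
have -> : k i = (j - 0) + 1 + (k i - j.+1) by lia.
have -> : (n i).+1 = 3 * k i + 1 by rewrite nE; lia.
apply: (@cov_cat _ _ _ _ _ _ _ _ _ _ (3 * j.+1 + 1)).
  apply: (@cov_cat _ _ _ _ _ _ _ _ _ _ (3 * j + 2)).
    apply: (@cov_run _ _ _ _ C _ _ 2 0) => // x xj.
    by split; [rewrite nE; lia | rewrite -addnS; apply: Lj].
  have -> : 3 * j.+1 + 1 = (3 * j + 2).+2 by lia.
  by apply: cov_pair; [rewrite nE; lia | apply: pairs].
apply: cov_run => // x xj.
by split; [rewrite nE; lia | rewrite -addnS; apply: Rj; lia].
Qed.

(** If the star of the center is broken, the remaining damage is below m.  Either
all legs are tiled from height 1 on, and it is enough to dominate the fiber
of the center by one vertex; or a star at some height 3a + 2 of leg i is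
broken too, and then the other legs are tiled from height 1 on, and the pair
at heights 0 and 1 of leg i is intact. *)
Lemma cover_residue0 : cov F (1 + \sum_j k j) setT.
Proof.
have [all|nall] : cov F (1 + \sum_j k j) setT \/ ~~ cov F (1 + \sum_j k j) setT.
  by case: (cov F _ _); [left | right].
  exact: all.
have legs i := cover_leg i nall.
have [okc|badc] := boolP (clean C F i0 0).
  by apply: (@cov_all_core _ _ _ _ C _ _ _ 2) => //; rewrite -(nbhd_pt0 C i0).
have [/forallP whole|/forallPn[i nwhole]] :=
    boolP [forall i, cov F (k i) (seg i 1 (n i).+1)].
  apply: (@cov_all_core _ _ _ _ C _ _ _ 1) => //.
  have /andP[c _] := target_ok C (n_gt0 i0) sF cF.
  apply: cov_sub c; apply/subsetP => v; rewrite !inE ltnS leqn0 => /eqP v0.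
  by apply/eqP/(@ht_inj _ _ _ C); rewrite ?(ht_pt C) // v0.
have [/forallP h|/forallPn[a bada]] :=
    boolP [forall a : 'I_(k i), clean C F i (3 * a + 2)].
  case/negP: nwhole; apply: run_whole => x xk; exact: (h (Ordinal xk)).
have ak := ltn_ord a.
have han : 3 * a + 2 <= n i by rewrite nE; lia.
rewrite -(sum_extra i); apply: (@cov_all_leg _ _ _ _ C _ _ i) => j.
case: eqVneq => [->|ji] /=; last first.
  rewrite addn0; apply: run_whole => x xk.
  have hxn : 3 * x + 2 <= n j by rewrite nE; lia.
  have f1 : far i0 0 i (3 * a + 2) by rewrite /far; lia.
  have f2 : far i0 0 j (3 * x + 2) by rewrite /far; lia.
  have f3 : far i (3 * a + 2) j (3 * x + 2) by rewrite /far eq_sym ji !addnS !orbT.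
  have := three_stars C (leq0n _) han hxn f1 f2 f3 sF cF3.
  by rewrite (negPf badc) (negPf bada).
have -> : k i + true = 1 + k i by rewrite addn1.
apply: cov_cat (legs i).
apply: (@cov_pair _ _ _ _ C _ i 0) => //.
have nin : pt i (3 * a + 2) \notin [set pt i 0; pt i 1].
  by apply: pt_notin => //; lia.
have := pair_or_star (n_gt0 i) nin sF cF.
by rewrite (negPf bada) orbF.
Qed.

End Cover.

Lemma pack_residue0 D i : dominating D -> k i <= wt D (seg i 2 (3 * k i + 2)).
Proof.
move=> dD; rewrite -[X in X <= _]subn0.
by apply: (@wt_run _ _ _ _ C _ _ 2 0) => // x xk; rewrite nE; lia.
Qed.

Lemma low2_residue0 D : dominating D -> 0 < wt D (low 2).
Proof. by move=> dD; rewrite -(nbhd_pt0 C i0); apply: wt_nbhd. Qed.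

Lemma lower_residue0 D : dominating D -> 1 + \sum_i k i <= #|D|.
Proof.
move=> dD.
apply: leq_trans (@wt_split _ _ _ _ C D 2 (fun i => 3 * k i + 2) isT).
rewrite leq_add ?low2_residue0 //; apply: leq_sum => i _.
exact: pack_residue0.
Qed.

(** A minimum dominating set has a single vertex y over N[center] and a single
vertex x over heights 2 to 4 of leg i0.  If y is not over height 1 of leg i0,
then x dominates heights 2 and 3 alone, against the matching between them.
If it is, then x dominates height 3 alone; the same matching pushes x above
height 2, so y dominates heights 0 and 1 alone, against the matching that
covers the fiber at height 1. *)
Lemma raise_residue0 : exists F, [/\ F \subset edges G, #|F| <= m + uphalf m &
  forall D, dominating (G := del_edges F) D -> 1 + \sum_i k i < #|D|].
Proof.
have n1 := n_gt0 i0.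
have n3 : 2 < n i0 by rewrite nE; have := k_gt0 i0; lia.
have n2 := ltnW n3.
have [P [sP cP PP]] := perfect_matching m (adj_pt C n3).
have c10 : adj (pt i0 1) (pt i0 0) by rewrite adj_sym adj_pt.
have [M [sM cM MP]] := near_matching m c10.
exists (P :|: M); split=> [||D dD].
- by rewrite subUset sP.
- by apply: leq_trans (leq_card_setU _ _) _; rewrite leq_add.
rewrite ltnNge; apply/negP => hD; have dD' := dominating_del_edges dD.
have [//||w2 wi] := @wt_tight _ _ _ _ C _ 2 (fun i => 3 * k i + 2) 1 k isT _ _ hD.
  exact: low2_residue0.
  by move=> i; apply: pack_residue0.
have w5 : wt D (seg i0 2 5) <= 1.
  have h : k i0 - 1 <= wt D (seg i0 (3 * 1 + 2) (3 * k i0 + 2)).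
    by apply: wt_run => // x xk; rewrite nE; lia.
  have := @wt_cat _ _ _ _ C D i0 2 5 (3 * k i0 + 2).
  by have := wi i0; have := k_gt0 i0; move: h; rewrite -[3 * 1 + 2]/5; lia.
have sub p : 0 < p <= 3 -> nbhd (pt i0 p) \subset seg i0 p.-1 p.+2.
  by move=> hp; apply: nbhd_seg; lia.
have s3 : nbhd (pt i0 3) \subset seg i0 2 5 by apply: sub.
have s0 : nbhd (pt i0 0) \subset low 2 by rewrite nbhd_pt0.
have [y yD y2] := dominated_nonempty dD s0.
have [x xD x5] := dominated_nonempty dD s3.
have loney := wt_le1 w2 yD y2; have lonex := wt_le1 w5 xD x5.
have hx : 2 <= ht x.2 <= 4 by move: x5; rewrite inE => /andP[].
have lx : lg x.2 = i0 by move: x5; rewrite inE; case: eqP hx => [->|_ _ /andP[_ /eqP]].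
have [y1|y1] := boolP (y.2 \in seg i0 1 2).
  have yE : y.2 = pt i0 1 by apply: seg1P y1.
  have x_ne2 : x.2 != pt i0 2.
    apply/eqP => xE; have [|z [zB nzx xzP]] := PP x; first by rewrite xE !inE eqxx.
    have z3 : z.2 = pt i0 3.
      by case/set2P: zB nzx => // ->; rewrite xE eqxx.
    have [|_ h] := lone_dominator (y := z) dD lonex; first by rewrite z3.
    by rewrite h ?eqxx // inE xzP in nzx.
  have hx3 : 3 <= ht x.2.
    rewrite ltn_neqAle; case/andP: hx => -> _; rewrite andbT.
    apply: contraNneq x_ne2 => hx2; apply/eqP/(@ht_inj _ _ _ C).
      by rewrite (ht_pt C).
    by rewrite lx lg_pt ?eqxx ?orbT.
  have [z [zB nzy yzM]] := MP y yE.
  have lone1 : {in D, forall w, w.2 \in seg i0 0 3 -> w = y}.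
    move=> w wD ws; have [w2'|w2'] := boolP (w.2 \in low 2); first exact: loney.
    have wx : w = x.
      apply: lonex => //; move: w2' ws; rewrite !inE -leqNgt.
      by move=> h2 /andP[/andP[_ h3] ->]; rewrite h2 (leq_trans h3).
    by move: ws hx3; rewrite wx inE => /andP[/andP[_ h3] _]; rewrite leqNgt h3.
  have lone2 : {in D, forall w, w.2 \in seg i0 0 3 :|: low 2 -> w = y}.
    by move=> w wD /setUP[]; [apply: lone1 | apply: loney].
  have [|_ h] := lone_dominator (y := z) dD lone2.
    case/set2P: zB => ->; first exact: subset_trans (sub 1 isT) (subsetUl _ _).
    exact: subset_trans s0 (subsetUr _ _).
  by rewrite h ?eqxx // inE yzM orbT in nzy.
have lone1 : {in D, forall w, w.2 \in seg i0 1 5 -> w = x}.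
  move=> w wD ws; have [w2'|w2'] := boolP (w.2 \in low 2).
    case/negP: y1; rewrite -(loney w wD w2'); move: ws w2'; rewrite !inE.
    by move=> /andP[/andP[-> _] ->] ->.
  apply: lonex => //; move: w2' ws; rewrite !inE -leqNgt.
  by move=> -> /andP[/andP[_ ->] ->].
have sub2 : nbhd (pt i0 2) \subset seg i0 1 5.
  by apply: subset_trans (sub 2 isT) _; apply: seg_sub.
have sub3 : nbhd (pt i0 3) \subset seg i0 1 5.
  by apply: subset_trans (sub 3 isT) _; apply: seg_sub.
have [x2 _] := lone_dominator (y := (Ordinal m_gt0, pt i0 2)) dD lone1 sub2.
have xB : x.2 \in [set pt i0 2; pt i0 3].
  have hx3 : ht x.2 <= 3.
    by move: x2; rewrite /= (cadj_ht C) (ht_pt C) // => /and3P[].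
  have : (x.2 \in seg i0 2 3) || (x.2 \in seg i0 3 4).
    rewrite !inE lx eqxx orbT !andbT.
    by move: (ht x.2) hx hx3 => h; clear; lia.
  by case/orP => /seg1P->; rewrite ?inE ?eqxx ?orbT.
have [z [zB nzx xzP]] := PP x xB.
have [|_ h] := lone_dominator (y := z) dD lone1; first by case/set2P: zB => ->.
by rewrite h ?eqxx // inE xzP in nzx.
Qed.

Lemma bondage_residue0 : bondage_number G = m + uphalf m.
Proof.
apply: (bondage_number_eq (N := 1 + \sum_i k i) product_edge).
- by rewrite addn_gt0 m_gt0.
- exact: lower_residue0.
- by move=> F sF cF; rewrite -fibT; apply: cover_residue0.
exact: raise_residue0.
Qed.

End Residue0.

End Cases.

Theorem theorem4p4 (m : nat) (l : nat) (n : 'I_l -> nat) (S : sgraph) (c : S)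
    (hm : 1 <= m) (hl : 2 <= l) (hS : starlike c n) :
  [/\ (forall i, n i = 1 %[mod 3]) ->
        bondage_number (strong_product (complete_graph m) S) = uphalf m,
      (forall i, n i = 2 %[mod 3]) ->
        bondage_number (strong_product (complete_graph m) S) = m &
      (forall i, n i = 0 %[mod 3]) ->
        bondage_number (strong_product (complete_graph m) S) = uphalf (3 * m)].
Proof.
have [C] := starlike_coordinates (ltnW hl) hS; have [_ _ n_gt0 _] := hS.
have i01 : Ordinal (ltnW hl) != Ordinal hl by [].
have divE r : r < 3 -> (forall i, n i = r %[mod 3]) ->
    forall i, n i = 3 * (n i %/ 3) + r.
  by move=> r3 hr i; rewrite {1}(divn_eq (n i) 3) hr modn_small // mulnC.
split=> [/(divE 1 isT)|/(divE 2 isT)|/(divE 0 isT)] nE.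
- exact: (bondage_residue1 C hm i01 n_gt0 nE).
- exact: (bondage_residue2 C hm i01 n_gt0 nE).
have nE0 i : n i = 3 * (n i %/ 3) by rewrite {1}nE addn0.
by rewrite (bondage_residue0 C hm i01 n_gt0 nE0); lia.
Qed.
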